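(* Let $n\ge 1$ and let $\mu$ be a probability measure on $\mathbb{R}^n$ with finite second moment, with mean $\mathbf{m}\neq 0$ and invertible covariance matrix $\Sigma$. Then $$G_2(\mu)=\sqrt{n}\,\gamma_{VN}(\mu)=\sqrt{\frac{n}{\mathbf{m}^T\Sigma^{-1}\mathbf{m}}}.$$
   Context: For a probability measure $\mu$ on $\mathbb{R}^n$ with $\int|\mathbf{x}|^2\mu(d\mathbf{x})<\infty$, mean $\mathbf{m}=\int \mathbf{x}\,\mu(d\mathbf{x})\ne 0$ and invertible covariance matrix $\Sigma$, the squared Gini index is $$G_2(\mu):=\Bigg(\frac{1}{2\mathbf{m}^T\Sigma^{-1}\mathbf{m}}\int_{\mathbb{R}^n}\int_{\mathbb{R}^n}(\mathbf{x}-\mathbf{y})^T\Sigma^{-1}(\mathbf{x}-\mathbf{y})\,\mu(d\mathbf{x})\,\mu(d\mathbf{y})\Bigg)^{1/2},$$ and the Voinov-Nikulin coefficient of variation is $$\gamma_{VN}(\mu):=\sqrt{\frac{1}{\mathbf{m}^T\Sigma^{-1}\mathbf{m}}}.$$ *)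

(* Defs.v *)
From HB Require Import structures.
From mathcomp Require Import all_boot all_order all_algebra.
From mathcomp Require Import all_classical all_reals all_analysis.

Set Implicit Arguments.
Unset Strict Implicit.
Unset Printing Implicit Defensive.

Import Order.TTheory GRing.Theory Num.Theory.
Import numFieldNormedType.Exports.

Local Open Scope classical_set_scope.
Local Open Scope ring_scope.

(* R^n as column vectors, with the Borel sigma-algebra of its (product)
   topology.  The type is convertible to 'cV[R]_n. *)
Definition borelRn (R : realType) (n : nat) :=
  g_sigma_algebraType (@open 'cV[R]_n).

Definition coordRn (R : realType) (n : nat) (i : 'I_n) (x : borelRn R n) : R :=
  (x : 'cV[R]_n) i 0.

(* The norm is the Euclidean one; the library norm `|x| on matrices is the sup
   norm. *)
Definition finite_second_moment (R : realType) (n : nat)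
    (mu : probability (borelRn R n) R) : Prop :=
  (\int[mu]_x (\sum_(i < n) coordRn i x ^+ 2)%:E < +oo)%E.

(* [fine] maps infinite or undefined values to 0; under a finite second moment
   the expectations, covariances and double integrals below are all finite. *)
Definition mean_vec (R : realType) (n : nat)
    (mu : probability (borelRn R n) R) : 'cV[R]_n :=
  \col_i fine ('E_mu[coordRn i])%E.

Definition cov_mx (R : realType) (n : nat)
    (mu : probability (borelRn R n) R) : 'M[R]_n :=
  \matrix_(i, j) fine (covariance mu (coordRn i) (coordRn j)).

Definition quad_form (R : realType) (n : nat) (A : 'M[R]_n) (v : 'cV[R]_n) : R :=
  (v^T *m A *m v) 0 0.

Definition gini2 (R : realType) (n : nat)
    (mu : probability (borelRn R n) R) : R :=
  let S := invmx (cov_mx mu) in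
  Num.sqrt (1 / (2 * quad_form S (mean_vec mu)) *
            fine (\int[mu]_y \int[mu]_x (quad_form S (x - y))%:E)%E).

Definition gammaVN (R : realType) (n : nat)
    (mu : probability (borelRn R n) R) : R :=
  Num.sqrt (1 / quad_form (invmx (cov_mx mu)) (mean_vec mu)).

(* Main.v *)
Require Import Defs.
From mathcomp Require Import all_boot all_order all_algebra.
From mathcomp Require Import all_classical all_reals all_analysis.
From mathcomp Require Import measurable_realfun ring lra.
Import numFieldNormedType.Exports.
Import Order.TTheory GRing.Theory Num.Theory.
Local Open Scope ring_scope.

(** Put [u = x - m] and [v = y - m].  Expanding [(u - v)^T S (u - v)] and
    integrating in [x] kills the cross terms, which leaves
    [tr (S Sigma) + v^T S v]; integrating in [y] then gives [2 tr (S Sigma)],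
    which is [2 n] when [S] is the inverse of [Sigma]. *)

Lemma quad_formE (R : realType) (n : nat) (A : 'M[R]_n) (v : 'cV[R]_n) :
  quad_form A v = \sum_i \sum_j A i j * (v i 0 * v j 0).
Proof.
rewrite /quad_form mxE exchange_big /=; apply: eq_bigr => j _.
rewrite mxE mulr_suml; apply: eq_bigr => i _.
by rewrite mxE; ring.
Qed.

(** Integrability and a real value travel together, so linearity composes term by term with no side
    condition on sums in the extended reals. *)
Definition has_integral {d : measure_display} {T : measurableType d}
    {R : realType} (P : probability T R) (f : T -> R) (c : R) : Prop :=
  P.-integrable setT (EFin \o f) /\ (\int[P]_x (f x)%:E = c%:E)%E.

Section HasIntegral.
Context {d : measure_display} {T : measurableType d} {R : realType}.
Variable P : probability T R.
Implicit Types (f g : T -> R) (a b c : R).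

Lemma has_integral_cst c : has_integral P (fun=> c) c.
Proof.
split; first exact: finite_measure_integrable_cst.
by rewrite (integral_cst P measurableT c%:E) [X in (_ * X)%E]probability_setT mule1.
Qed.

Lemma has_integralD f g a b : has_integral P f a -> has_integral P g b ->
  has_integral P (fun x => f x + g x) (a + b).
Proof.
move=> [If Ef] [Ig Eg]; split; first exact: (integrableD measurableT If Ig).
by rewrite EFinD -Ef -Eg -(integralD_EFin measurableT If Ig).
Qed.

Lemma has_integralZ k f a : has_integral P f a ->
  has_integral P (fun x => k * f x) (k * a).
Proof.
move=> [If Ef]; split; first exact: (integrableZl measurableT k If).
by rewrite EFinM -Ef -(integralZl measurableT If).
Qed.

Lemma has_integral_sum (I : Type) (s : seq I) (f : I -> T -> R) (a : I -> R) :
  (forall i, has_integral P (f i) (a i)) ->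
  has_integral P (fun x => \sum_(i <- s) f i x) (\sum_(i <- s) a i).
Proof.
move=> Hf; elim: s => [|i s IHs].
  under [fun x => _]eq_fun do rewrite big_nil.
  by rewrite big_nil; exact: has_integral_cst.
under [fun x => _]eq_fun do rewrite big_cons.
by rewrite big_cons; exact: has_integralD.
Qed.

(** Integrability makes the integral finite, so [fine] loses nothing; this justifies the [fine] in
    [mean_vec] and [cov_mx]. *)
Lemma has_integral_fine f : P.-integrable setT (EFin \o f) ->
  has_integral P f (fine (\int[P]_x (f x)%:E)%E).
Proof. by move=> If; split => //; rewrite fineK//; exact: integrable_fin_num. Qed.

End HasIntegral.

(** Open intervals generate the Borel sets of the line, and their preimages under the continuous
    coordinate map are open, hence generators on the source. *)
Lemma measurable_coordRn (R : realType) (n : nat) (i : 'I_n) :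
  measurable_fun setT (@coordRn R n i).
Proof.
apply: (measurability _ (RGenOpens.measurableE R)).
move=> _ [_ [a [b ->] <-]]; rewrite setTI.
apply: sub_sigma_algebra.
have /continuousP cc : continuous (fun M : 'cV[R]_n => M i 0).
  by move=> M; exact: coord_continuous.
exact/cc/interval_open.
Qed.

Section Moments.
Context {R : realType} {n : nat}.
Variable mu : probability (borelRn R n) R.
Hypothesis hmu : finite_second_moment mu.

Let centered (i : 'I_n) (x : borelRn R n) : R := coordRn i x - mean_vec mu i 0.

(** The function 1 + |x|^2 is the common dominating function for all monomials of degree 1 and 2 in
    the coordinates. *)
Lemma integrable_sqr_normD1 :
  mu.-integrable setT (fun x => (1 + \sum_(i < n) coordRn i x ^+ 2)%:E).
Proof.
apply: (@integrableD _ _ _ mu _ measurableT (EFin \o cst 1)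
  (fun x => (\sum_(i < n) coordRn i x ^+ 2)%:E)).
  exact: finite_measure_integrable_cst.
apply/integrableP; split.
  apply/measurable_EFinP; apply: measurable_sum => i.
  by apply: measurable_funX; exact: measurable_coordRn.
rewrite (eq_integral (fun x => (\sum_(i < n) coordRn i x ^+ 2)%:E)) => [//|x _].
by rewrite gee0_abs// lee_fin sumr_ge0// => i _; exact: sqr_ge0.
Qed.

Lemma sqr_coord_le i (x : borelRn R n) :
  coordRn i x ^+ 2 <= \sum_(i < n) coordRn i x ^+ 2.
Proof. by rewrite (bigD1 i)//= lerDl sumr_ge0// => j _; exact: sqr_ge0. Qed.

Lemma dominated_integrable (f : borelRn R n -> R) :
  measurable_fun setT f ->
  (forall x, `|f x| <= 1 + \sum_(i < n) coordRn i x ^+ 2) ->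
  mu.-integrable setT (EFin \o f).
Proof.
move=> mf fb; apply: (le_integrable measurableT _ _ integrable_sqr_normD1).
  exact/measurable_EFinP.
move=> x _ /=; rewrite lee_fin; apply: (le_trans (fb x)); exact: ler_norm.
Qed.

Lemma integrable_coord i : mu.-integrable setT (EFin \o @coordRn R n i).
Proof.
apply: dominated_integrable; first exact: measurable_coordRn.
move=> x; apply: le_trans (_ : 1 + coordRn i x ^+ 2 <= _); last first.
  by rewrite lerD2l sqr_coord_le.
(* With t^2 written as |t|^2, the bound |t| <= 1 + t^2 is polynomial in |t|. *)
rewrite -[X in 1 + X]real_normK ?num_real//; nra.
Qed.

Lemma integrable_coordM i j :
  mu.-integrable setT (EFin \o (fun x => @coordRn R n i x * coordRn j x)).
Proof.
apply: dominated_integrable.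
  by apply: measurable_funM; exact: measurable_coordRn.
move=> x; have := sqr_coord_le i x; have := sqr_coord_le j x.
(* Here |ab| <= (a^2 + b^2) / 2, and each square is at most the full sum. *)
by rewrite ler_norml => *; apply/andP; split; nra.
Qed.

Lemma has_integral_centered i : has_integral mu (centered i) 0.
Proof.
rewrite -(subrr (mean_vec mu i 0)); apply: has_integralD; last first.
  exact: has_integral_cst.
by rewrite mxE unlock; apply: has_integral_fine; exact: integrable_coord.
Qed.

Lemma has_integral_centeredM i j :
  has_integral mu (fun x => centered i x * centered j x) (cov_mx mu i j).
Proof.
(* Unfolded, the covariance centers each variable at the [fine] of its expectation, which is the
   entry of [mean_vec]. *)
have -> : cov_mx mu i j = fine (\int[mu]_x (centered i x * centered j x)%:E)%E.
  rewrite mxE [in LHS]unlock [in LHS]unlock.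
  by congr fine; apply: eq_integral => x _; rewrite /centered !mxE [in RHS]unlock.
apply: has_integral_fine.
set a := mean_vec mu i 0; set b := mean_vec mu j 0.
(* Only integrability of the expanded product is wanted; the value [c] is left to unification. *)
have [c [+ _]] : exists c, has_integral mu (fun x => coordRn i x * coordRn j x
    + (- b * coordRn i x + - a * coordRn j x) + a * b) c.
  eexists; apply: has_integralD; last exact: has_integral_cst.
  apply: has_integralD; first exact/has_integral_fine/integrable_coordM.
  by apply: has_integralD; apply: has_integralZ;
    exact/has_integral_fine/integrable_coord.
congr (mu.-integrable _ _); apply/funext => x /=; congr EFin.
by rewrite /centered -/a -/b; ring.
Qed.

Lemma cov_mxC i j : cov_mx mu i j = cov_mx mu j i.
Proof. by rewrite !mxE covarianceC. Qed.

(** This is the inner integral, with [y] fixed. The value stays a double sum so that the outer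
    integral can again be taken entry by entry. *)
Lemma has_integral_quad_form_sub (S : 'M[R]_n) (y : 'cV[R]_n) :
  has_integral mu (fun x => quad_form S (x - y))
    (\sum_i \sum_j S i j * (cov_mx mu i j + centered i y * centered j y)).
Proof.
under [fun x => _]eq_fun do rewrite quad_formE.
apply: has_integral_sum => i; apply: has_integral_sum => j.
apply: has_integralZ.
have -> : (fun x : borelRn R n => (x - y : 'cV[R]_n) i 0 * (x - y : 'cV[R]_n) j 0) =
  (fun x => centered i x * centered j x + ((- centered j y) * centered i x +
     ((- centered i y) * centered j x + centered i y * centered j y))).
  by apply/funext => x; rewrite /centered /coordRn !mxE; ring.
(* The zeros are the means of the centered coordinates in the cross terms; the value now mirrors the
   shape of the integrand. *)
have -> : cov_mx mu i j + centered i y * centered j y = cov_mx mu i j +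
   (- centered j y * 0 + (- centered i y * 0 + centered i y * centered j y)).
  by ring.
apply: has_integralD; first exact: has_integral_centeredM.
apply: has_integralD; first exact/has_integralZ/has_integral_centered.
apply: has_integralD; first exact/has_integralZ/has_integral_centered.
exact: has_integral_cst.
Qed.

Lemma double_integral_quad_form (S : 'M[R]_n) :
  (\int[mu]_y \int[mu]_x (quad_form S ((x : 'cV[R]_n) - y))%:E =
   (2 * \tr (S *m cov_mx mu))%:E)%E.
Proof.
under eq_integral do rewrite (has_integral_quad_form_sub _ _).2.
have -> : 2 * \tr (S *m cov_mx mu) =
    \sum_i \sum_j S i j * (cov_mx mu i j + cov_mx mu i j).
  rewrite mulr_sumr; apply: eq_bigr => i _; rewrite mxE mulr_sumr.
  (* The trace pairs [S i j] with [cov_mx mu j i], hence the appeal to symmetry. *)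
  by apply: eq_bigr => j _; rewrite (cov_mxC j i); ring.
(* Restoring the integrability half turns the equation into a [has_integral] goal. *)
apply: (proj2 (A := mu.-integrable setT (EFin \o _))).
apply: has_integral_sum => i; apply: has_integral_sum => j; apply: has_integralZ.
apply: has_integralD; first exact: has_integral_cst.
exact: has_integral_centeredM.
Qed.

End Moments.

Theorem theorem1 (R : realType) (n : nat) (hn : (1 <= n)%N)
    (mu : probability (borelRn R n) R)
    (hmu : finite_second_moment mu)
    (hm : mean_vec mu != 0)
    (hS : cov_mx mu \in unitmx) :
  gini2 mu = Num.sqrt n%:R * gammaVN mu /\
  Num.sqrt n%:R * gammaVN mu =
    Num.sqrt (n%:R / quad_form (invmx (cov_mx mu)) (mean_vec mu)).
Proof.
have sqrtE : Num.sqrt n%:R * gammaVN mu =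
    Num.sqrt (n%:R / quad_form (invmx (cov_mx mu)) (mean_vec mu)).
  by rewrite /gammaVN -sqrtrM ?ler0n// mul1r.
split; last exact: sqrtE.
rewrite sqrtE /gini2 double_integral_quad_form// mulVmx// mxtrace1 /=.
(* The integral is now 2n; its 2 cancels against the normalizing 1/2, and the quadratic form stays
   as common denominator. *)
congr Num.sqrt; rewrite mul1r invfM mulrC mulrA; congr (_ / _).
by rewrite mulrC mulrA mulVf ?mul1r// pnatr_eq0.
Qed.
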